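(* Let $d \ge 1$, let $F \in \mathcal{S}_d$ be a (nonzero) form and let $\mathcal{Z}$ be a scheme evinced by a local GAD of $F$. Then $$\mathrm{len}\,\mathcal{Z} \le \begin{cases} \dfrac{n+2k}{k}\dbinom{n+k-1}{n} & \text{if } d = 2k,\\[2mm] 2\dbinom{n+k}{n} & \text{if } d = 2k+1.\end{cases}$$
   Context: Let $n \ge 1$ be an integer, $\Bbbk$ a field whose characteristic is zero or strictly larger than $d$, $\mathcal{S} = \bigoplus_d \mathcal{S}_d = \Bbbk[x_0,\dots,x_n]$ and $\mathcal{R} = \Bbbk[y_0,\dots,y_n]$ with standard gradings. Local GAD: for a nonzero form $F \in \mathcal{S}_d$ and a nonzero linear form $\ell \in \mathcal{S}_1$ there is a unique way of writing $F = \omega\,\ell^{d-j}$ with $0 \le j \le d$, $\omega \in \mathcal{S}_j$ and $\ell \nmid \omega$; this is the local generalized additive decomposition (local GAD) of $F$ supported at $\ell$ (the case $F = F\ell^0$ is allowed). Dual generator: given $\ell$, complete it to a basis $(\ell, z_1,\dots,z_n)$ of $\mathcal{S}_1$ (for $\ell = x_0 + \xi_1x_1+\dots+\xi_nx_n$ one takes $z_i = x_i$). Write $F$ as a polynomial in $\ell, z_1,\dots,z_n$, $F = \sum F_{\alpha_0,\alpha}\,\ell^{\alpha_0} z^{\alpha}$, form its divided power representation $F_{\rm dp} = \sum \alpha_0!\,\alpha!\,F_{\alpha_0,\alpha}\,\ell^{\alpha_0}z^\alpha$, and set $\ell = 1$: this gives $f_\ell = \sum \alpha_0!\,\alpha!\,F_{\alpha_0,\alpha}\,z^\alpha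 \in \Bbbk[z_1,\dots,z_n]_{\le d}$. Evinced scheme: let $(Y_0,\dots,Y_n)$ be the basis of $\mathcal{R}_1$ dual to $(\ell,z_1,\dots,z_n)$ (with $y_i$ dual to $x_i$). Let $\Bbbk[Y_1,\dots,Y_n]$ act on $\Bbbk[z_1,\dots,z_n]$ by contraction: $Y^\beta \lrcorner z^\alpha = z^{\alpha-\beta}$ if $\alpha \ge \beta$ componentwise and $0$ otherwise. Let $\mathrm{Ann}^{\lrcorner}(f_\ell) = \{g \in \Bbbk[Y_1,\dots,Y_n] : g \lrcorner f_\ell = 0\}$. The homogenization of this ideal with respect to $Y_0$ is the ideal of a zero-dimensional scheme $\mathcal{Z} \subset \mathbb{P}^n(\Bbbk)$ supported at the point of coefficients of $\ell$; it is the scheme evinced by the local GAD of $F$ at $\ell$ (it does not depend on the choice of $z_1,\dots,z_n$). Its length is $\mathrm{len}\,\mathcal{Z} = \dim_\Bbbk \Bbbk[Y_1,\dots,Y_n]/\mathrm{Ann}^{\lrcorner}(f_\ell)$. *)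

(* Defs.v *)
From HB Require Import structures.
From mathcomp Require Import all_boot all_order all_algebra.
From mathcomp Require Export mpoly.

Set Implicit Arguments.
Unset Strict Implicit.
Unset Printing Implicit Defensive.

Import GRing.Theory.
Local Open Scope ring_scope.

(* S = K[x_0, ..., x_n] is {mpoly K[n.+1]}.  The ring R = K[y_0, ..., y_n] is
   also {mpoly K[n.+1]}, written in the basis (Y_0, ..., Y_n) of R_1 dual to the
   chosen basis (l, z_1, ..., z_n) of S_1: the variable 'X_0 stands for Y_0 and
   'X_(lift ord0 i) for Y_(i+1).  The rings K[z_1, ..., z_n] and
   K[Y_1, ..., Y_n] are {mpoly K[n]}. *)

Section Defs.
Variables (K : fieldType) (n : nat).

Implicit Types (F l omega : {mpoly K[n.+1]}) (f g : {mpoly K[n]}).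

Definition local_GAD (d : nat) F l (j : nat) omega : Prop :=
  [/\ l \is 1.-homog /\ l != 0,
      (j <= d)%N,
      omega \is j.-homog,
      F = omega * l ^+ (d - j)
    & ~ exists q, omega = q * l].

Definition linear_basis (b : (n.+1).-tuple {mpoly K[n.+1]}) : Prop :=
  (forall i, tnth b i \is 1.-homog) /\
  forall L : {mpoly K[n.+1]}, L \is 1.-homog ->
    exists! c : {ffun 'I_n.+1 -> K}, L = \sum_i c i *: tnth b i.

Definition divided_power (G : {mpoly K[n.+1]}) : {mpoly K[n.+1]} :=
  \sum_(m <- msupp G) ((\prod_(i < n.+1) (m i)`!)%:R * G@_m) *: 'X_[m].

Definition set_first_to_one (G : {mpoly K[n.+1]}) : {mpoly K[n]} :=
  G \mPo [tuple (if unlift ord0 i is Some j then 'X_j else 1) | i < n.+1].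

(* G is the expression of F as a polynomial in l, z_1, ..., z_n. *)
Definition dual_generator F l (z : n.-tuple {mpoly K[n.+1]}) f : Prop :=
  exists2 G : {mpoly K[n.+1]},
    G \mPo [tuple of l :: z] = F & f = set_first_to_one (divided_power G).

Definition contract g f : {mpoly K[n]} :=
  \sum_(b <- msupp g) \sum_(a <- msupp f | (b <= a)%MM)
    (g@_b * f@_a) *: 'X_[a - b].

Definition Ann f : {mpoly K[n]} -> Prop := fun g => contract g f = 0.

Definition homogenization g : {mpoly K[n.+1]} :=
  \sum_(m <- msupp g)
    g@_m *: ('X_ord0 ^+ ((msize g).-1 - mdeg m)
             * \prod_(i < n) 'X_(lift ord0 i) ^+ m i).

Definition ideal_generated (k : nat) (P : {mpoly K[k]} -> Prop) :
    {mpoly K[k]} -> Prop :=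
  fun G => exists s : seq ({mpoly K[k]} * {mpoly K[k]}),
    (forall cg, cg \in s -> P cg.2) /\ G = \sum_(cg <- s) cg.1 * cg.2.

Definition homogenized_ideal (I : {mpoly K[n]} -> Prop) :
    {mpoly K[n.+1]} -> Prop :=
  ideal_generated (fun G => exists2 g, I g & G = homogenization g).

(* A closed subscheme of P^n is represented by its homogeneous ideal in the
   coordinates Y_0, ..., Y_n, for which l is the point (1 : 0 : ... : 0). *)
Definition evinced (d : nat) F (Z : {mpoly K[n.+1]} -> Prop) : Prop :=
  exists (l : {mpoly K[n.+1]}) (j : nat) (omega : {mpoly K[n.+1]})
         (z : n.-tuple {mpoly K[n.+1]}) (f : {mpoly K[n]}),
    [/\ local_GAD d F l j omega,
        linear_basis [tuple of l :: z],
        dual_generator F l z f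
      & forall G, Z G <-> homogenized_ideal (Ann f) G].

Definition chart_ideal (Z : {mpoly K[n.+1]} -> Prop) : {mpoly K[n]} -> Prop :=
  fun g => exists2 G, Z G & g = set_first_to_one G.

(* The residue classes of b_0, ..., b_(r-1) form a K-basis of the quotient by
   I. *)
Definition quotient_dim (I : {mpoly K[n]} -> Prop) (r : nat) : Prop :=
  exists b : 'I_r -> {mpoly K[n]},
    forall g, exists! c : {ffun 'I_r -> K}, I (g - \sum_i c i *: b i).

(* For Z supported at (1 : 0 : ... : 0), as any evinced scheme is, Z lies in
   the chart Y_0 != 0, so that its length is the dimension of the coordinate
   ring of its trace there.  For Z evinced with dual generator f, chart_ideal Z
   is Ann f, and the length is the dimension of K[Y_1, ..., Y_n] / Ann f. *)
Definition scheme_length (Z : {mpoly K[n.+1]} -> Prop) (r : nat) : Prop :=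
  quotient_dim (chart_ideal Z) r.

End Defs.

(* Main.v *)
(** Contraction against [f] identifies [K[Y] / Ann f] with the row space of the
    Hankel (catalecticant) matrix with entries [f_(a + b)], so the length is the
    rank of that matrix.  Since [deg f <= d], the entries vanish for
    [deg a + deg b > d]; hence for every [s] all nonzero entries lie in the rows
    with [deg a < s] or in the columns with [deg b <= d - s], and the rank is at
    most the number of monomials of degree [< s] plus the number of those of
    degree [<= d - s].  Take [s = k] if [d = 2k] and [s = k + 1] if
    [d = 2k + 1]. *)

Require Import Defs.
From mathcomp Require Import all_boot all_order all_algebra.
From mathcomp Require Import ssrcomplements.
Import GRing.Theory Num.Theory.
Local Open Scope ring_scope.

(** * Contraction, its Hankel matrix and the rank bound *)

Section Contraction.
Set Implicit Arguments.
Unset Strict Implicit.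

Variables (K : fieldType) (n : nat).
Implicit Types (f g : {mpoly K[n]}) (a m : 'X_{1..n}).

Lemma mcoeff_contract g f a :
  (contract g f)@_a = \sum_(b <- msupp g) g@_b * f@_(a + b).
Proof.
rewrite /contract raddf_sum; apply: eq_bigr => b _ /=.
(* Subtraction of exponents truncates at 0, so [c - b = a] yields [c = a + b] only together with
   [b <= c]. *)
have nz_term c : ~~ ((c - b)%MM == a) || ~~ (b <= c)%MM || (c == (a + b)%MM).
  apply/orP; case: (boolP (b <= c)%MM) => [le_bc|_]; last by left; rewrite orbT.
  by rewrite orbF; case: eqP => [<-|_]; [right; rewrite submK | left].
rewrite raddf_sum /= big_mkcond /=.
have [ab_f|ab_f] := boolP ((a + b)%MM \in msupp f).
  rewrite (bigD1_seq (a + b)%MM) ?msupp_uniq //= lem_addl.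
  rewrite mcoeffZ mcoeffX addmK eqxx mulr1 big1 ?addr0 // => c ne_c.
  case: ifP => // le_bc; rewrite mcoeffZ mcoeffX.
  by move: (nz_term c); rewrite le_bc (negbTE ne_c) !orbF => /negbTE->; rewrite mulr0.
rewrite (memN_msupp_eq0 ab_f) mulr0 big1_seq // => c /andP[_ c_f].
case: ifP => // le_bc; rewrite mcoeffZ mcoeffX.
have ne_c : (c == (a + b)%MM) = false.
  by apply/negbTE; apply: contra ab_f => /eqP <-.
by move: (nz_term c); rewrite le_bc ne_c !orbF => /negbTE->; rewrite mulr0.
Qed.

Lemma mcoeff_contractMX g f m a :
  (contract (g * 'X_[m]) f)@_a = (contract g f)@_(a + m).
Proof.
rewrite !mcoeff_contract (perm_big _ (msuppMX g m)) big_map.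
by apply: eq_bigr => b _; rewrite mcoeffMX addmA.
Qed.

Lemma Ann_MX f g m : Ann f g -> Ann f (g * 'X_[m]).
Proof.
by move=> g0; apply/mpolyP => a; rewrite mcoeff_contractMX g0 !mcoeff0.
Qed.

Definition coef_row (w : nat) g : 'rV[K]_#|{: 'X_{1..n < w}}| :=
  \row_i g@_(enum_val i : 'X_{1..n < w}).

Definition hankel (w : nat) f : 'M[K]_#|{: 'X_{1..n < w}}| :=
  \matrix_(i, j)
    f@_((enum_val i : 'X_{1..n < w}) + (enum_val j : 'X_{1..n < w})).

Lemma coef_row_lincomb (w r : nat) g (c : 'I_r -> K) (b : 'I_r -> {mpoly K[n]}) :
  coef_row w (g - \sum_i c i *: b i) =
  coef_row w g - \sum_i c i *: coef_row w (b i).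
Proof.
apply/rowP => j; rewrite !mxE summxE mcoeffB raddf_sum /=; congr (_ - _).
by apply: eq_bigr => i _; rewrite mcoeffZ !mxE.
Qed.

Lemma coef_row_surj (w : nat) (u : 'rV[K]_#|{: 'X_{1..n < w}}|) :
  {g | coef_row w g = u}.
Proof.
exists (\sum_i u 0 i *: 'X_[(enum_val i : 'X_{1..n < w})]).
apply/rowP => j; rewrite mxE raddf_sum (bigD1 j) //= mcoeffZ mcoeffX eqxx mulr1.
rewrite big1 ?addr0 // => i ne_ij; rewrite mcoeffZ mcoeffX.
by rewrite val_eqE (inj_eq enum_val_inj) (negbTE ne_ij) mulr0.
Qed.

Lemma mcoeff_contract_bound (w : nat) g f a : (msize f <= w)%N ->
  (contract g f)@_a = \sum_(b : 'X_{1..n < w}) g@_b * f@_(a + b).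
Proof.
move=> le_fw; rewrite mcoeff_contract.
rewrite (bigID (fun b => mdeg b < w)%N) /= [X in _ + X]big1 ?addr0; last first.
  move=> b; rewrite -leqNgt => le_wb.
  rewrite (memN_msupp_eq0 (_ : (a + b)%MM \notin _)) ?mulr0 //.
  by apply: msize_mdeg_ge; rewrite mdegD (leq_trans le_fw) // (leq_trans le_wb) ?leq_addl.
rewrite (big_mksub_cond ('X_{1..n < w} : subFinType _)) ?msupp_uniq //=.
rewrite big_mkcond; apply: eq_bigr => b _; rewrite bmdeg /=.
by case: ifPn => // /memN_msupp_eq0->; rewrite mul0r.
Qed.

(** The product lists the coefficients of [contract g f] at monomials of degree below [w]. Since
    [msize f] is one more than the degree of a nonzero [f], every coefficient of [f] in degree at
    least [w] vanishes, so truncating both [g] and the contraction to degrees below [w] loses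
    nothing. *)
Lemma AnnE (w : nat) g f : (msize f <= w)%N ->
  Ann f g <-> coef_row w g *m hankel w f = 0.
Proof.
move=> le_fw.
have entry j : (coef_row w g *m hankel w f) 0 j =
    (contract g f)@_(enum_val j : 'X_{1..n < w}).
  rewrite (mcoeff_contract_bound _ _ le_fw) mxE.
  rewrite [RHS](reindex _ (onW_bij _ (enum_val_bij _))) /=.
  by apply: eq_bigr => i _; rewrite !mxE addmC.
split=> [g0|g0]; first by apply/rowP => j; rewrite entry g0 mcoeff0 mxE.
apply/mpolyP => a; rewrite mcoeff0.
have [lt_aw|le_wa] := ltnP (mdeg a) w.
  by have := entry (enum_rank (BMultinom lt_aw)); rewrite g0 mxE enum_rankK.
rewrite (mcoeff_contract_bound _ _ le_fw) big1 // => b _.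
rewrite (memN_msupp_eq0 (_ : (a + b)%MM \notin _)) ?mulr0 //.
by apply: msize_mdeg_ge; rewrite mdegD (leq_trans le_fw) // (leq_trans le_wa) ?leq_addr.
Qed.

(** The sum in [contract] ranges over the support of [g], which hides its additivity; as the kernel
    of a matrix, [Ann f] is visibly a linear subspace. *)
Lemma AnnD f g1 g2 : Ann f g1 -> Ann f g2 -> Ann f (g1 + g2).
Proof.
rewrite !(AnnE _ (leqnn (msize f))) => g10 g20.
rewrite (_ : coef_row _ _ = coef_row (msize f) g1 + coef_row (msize f) g2).
  by rewrite mulmxDl g10 g20 addr0.
by apply/rowP => i; rewrite !mxE mcoeffD.
Qed.

Lemma AnnZ f c g : Ann f g -> Ann f (c *: g).
Proof.
rewrite !(AnnE _ (leqnn (msize f))) => g0.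
rewrite (_ : coef_row _ _ = c *: coef_row (msize f) g).
  by rewrite -scalemxAl g0 scaler0.
by apply/rowP => i; rewrite !mxE mcoeffZ.
Qed.

Lemma Ann0 f : Ann f 0.
Proof. by rewrite /Ann /contract msupp0 big_nil. Qed.

Lemma Ann_mull f c g : Ann f g -> Ann f (c * g).
Proof.
move=> g0; rewrite mulrC [c]mpolyE mulr_sumr.
elim/big_ind: _ => [||m _]; [exact: Ann0|exact: AnnD|].
by rewrite -scalerAr; apply/AnnZ/Ann_MX.
Qed.

(** The linear map sending [g] to [coef_row w g *m hankel w f] has kernel [Ann f] and image the row
    space of the matrix, so preimages of a basis of that row space represent a basis of the
    quotient. *)
Lemma quotient_dim_hankel (w : nat) f (I : {mpoly K[n]} -> Prop) :
    (msize f <= w)%N -> (forall g, I g <-> Ann f g) ->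
  quotient_dim I (\rank (hankel w f)).
Proof.
move=> le_fw IE; set A := hankel w f.
(* The generalized inverse provides a coefficient row that [A] maps to the [i]-th basis row; [b i]
   is a polynomial with these coefficients. *)
pose b i := sval (coef_row_surj (row i (row_base A) *m pinvmx A)).
have bA i : coef_row w (b i) *m A = row i (row_base A).
  rewrite (svalP (coef_row_surj _)) mulmxKpV //.
  by rewrite (submx_trans (row_sub i _)) ?eq_row_base.
have IcE g (c : 'I_(\rank A) -> K) : I (g - \sum_i c i *: b i) <->
    coef_row w g *m A = (\row_i c i) *m row_base A.
  rewrite IE (AnnE _ le_fw) coef_row_lincomb mulmxBl mulmx_suml.
  rewrite [X in _ <-> _ = X]mulmx_sum_row.
  rewrite (eq_bigr (fun i => (\row_i c i) 0 i *: row i (row_base A))).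
    by split=> [/subr0_eq|->]; last by rewrite subrr.
  by move=> i _; rewrite -scalemxAl bA mxE.
exists b => g; pose c := coef_row w g *m A *m pinvmx (row_base A).
have cE : c *m row_base A = coef_row w g *m A.
  by rewrite mulmxKpV // eq_row_base submxMl.
exists [ffun i => c 0 i]; split=> [|c'].
  apply/IcE; rewrite -cE; congr (_ *m _).
  by apply/rowP => i; rewrite [RHS]mxE ffunE.
move/IcE; rewrite -cE => /(row_free_inj (row_base_free A)) cc'.
by apply/ffunP => i; rewrite ffunE [c]cc' mxE.
Qed.

(** The matrix splits into its rows of degree below [s] and the remaining rows, which are nonzero
    only in columns of degree below [w - s]. Each piece factors through the corresponding set of
    monomials, whose size bounds its rank. *)
Lemma rank_hankel_le (w s : nat) f : (msize f <= w)%N -> (s <= w)%N ->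
  (\rank (hankel w f) <= #|{: 'X_{1..n < s}}| + #|{: 'X_{1..n < w - s}}|)%N.
Proof.
move=> le_fw le_sw.
pose T r := 'X_{1..n < r}.
pose U1 : 'M[K]_(#|{: T w}|, #|{: T s}|) := \matrix_(i, j)
  ((enum_val i : T w) == (enum_val j : T s) :> 'X_{1..n})%:R.
pose V1 : 'M[K]_(#|{: T s}|, #|{: T w}|) := \matrix_(i, j)
  f@_((enum_val i : T s) + (enum_val j : T w)).
(* Rows of degree below [s] are zero here because [U1 *m V1] already reproduces them. *)
pose U2 : 'M[K]_(#|{: T w}|, #|{: T (w - s)%N}|) := \matrix_(i, j)
  if (mdeg (enum_val i : T w) < s)%N then 0
  else f@_((enum_val i : T w) + (enum_val j : T (w - s)%N)).
pose V2 : 'M[K]_(#|{: T (w - s)%N}|, #|{: T w}|) := \matrix_(i, j)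
  ((enum_val i : T (w - s)%N) == (enum_val j : T w) :> 'X_{1..n})%:R.
have -> : hankel w f = U1 *m V1 + U2 *m V2.
  apply/matrixP => i j; rewrite !mxE.
  have [lt_is|le_si] := ltnP (mdeg (enum_val i : T w)) s.
    rewrite [X in _ + X]big1 ?addr0; last by move=> k _; rewrite !mxE lt_is mul0r.
    rewrite (bigD1 (enum_rank (BMultinom lt_is))) //= !mxE enum_rankK eqxx mul1r.
    rewrite big1 ?addr0 // => k ne_k; rewrite !mxE.
    case: eqP => [eq_ik|]; last by rewrite mul0r.
    case/eqP: ne_k; apply: enum_val_inj; rewrite enum_rankK.
    exact/val_inj/esym.
  rewrite [X in X + _]big1 ?add0r; last first.
    move=> k _; rewrite !mxE; case: eqP => [eq_ik|]; last by rewrite mul0r.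
    by move: (bmdeg (enum_val k)); rewrite -eq_ik ltnNge le_si.
  have [lt_jws|le_wsj] := ltnP (mdeg (enum_val j : T w)) (w - s).
    rewrite (bigD1 (enum_rank (BMultinom lt_jws))) //= !mxE enum_rankK eqxx mulr1.
    rewrite ltnNge le_si /= big1 ?addr0 // => k ne_k; rewrite !mxE.
    case: eqP => [eq_kj|]; last by rewrite mulr0.
    case/eqP: ne_k; apply: enum_val_inj; rewrite enum_rankK.
    exact/val_inj.
  rewrite big1 => [|k _]; last first.
    rewrite !mxE; case: eqP => [eq_kj|]; last by rewrite mulr0.
    by move: (bmdeg (enum_val k)); rewrite eq_kj ltnNge le_wsj.
  apply/memN_msupp_eq0/msize_mdeg_ge; rewrite mdegD (leq_trans le_fw) //.
  by rewrite (leq_trans _ (leq_add le_si le_wsj)) // subnKC.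
rewrite (leq_trans (mxrank_add _ _)) // leq_add //.
  by rewrite (leq_trans (mulmx_max_rank _ _)).
by rewrite (leq_trans (mulmx_max_rank _ _)).
Qed.

End Contraction.

(** * Counting monomials of bounded degree *)

Lemma card_bmultinom_le (n s : nat) :
  (#|{: 'X_{1..n < s.+1}}| <= 'C(s + n, n))%N.
Proof.
(* Homogenizing with an extra variable embeds these monomials into those of degree exactly [s] in
   [n.+1] variables. *)
pose h (m : 'X_{1..n < s.+1}) : 'X_{1..n.+1} :=
  [multinom (if unlift ord0 i is Some j then m j else s - mdeg m)%N | i < n.+1].
have h_inj : injective h.
  move=> m1 m2 /mnmP eq_h; apply/val_inj/mnmP => j.
  by have := eq_h (lift ord0 j); rewrite !mnmE liftK.
rewrite -(bin_sub (leq_addl s n)) addnK -mpoly.size_basis cardE.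
rewrite -(size_map h).
apply: uniq_leq_size => [|_ /mapP[m _ ->]].
  by rewrite map_inj_uniq ?enum_uniq.
rewrite -basis_cover mdegE big_ord_recl mnmE unlift_none.
rewrite (eq_bigr m) => [|j _]; last by rewrite mnmE liftK.
by rewrite -mdegE subnK // -ltnS bmdeg.
Qed.

(** * Linear changes of variables, dehomogenization and the chart ideal *)

Section Substitution.
Set Implicit Arguments.
Unset Strict Implicit.

Variable K : fieldType.

Lemma comp_mpolyA (n k l : nat) (p : {mpoly K[n]}) (t : n.-tuple {mpoly K[k]})
    (u : k.-tuple {mpoly K[l]}) :
  (p \mPo t) \mPo u = p \mPo [tuple tnth t i \mPo u | i < n].
Proof.
rewrite [p \mPo t]comp_mpolyE raddf_sum [RHS]comp_mpolyE; apply: eq_bigr => m _ /=.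
rewrite comp_mpolyZ rmorph_prod; congr (_ *: _); apply: eq_bigr => i _.
by rewrite rmorphXn tnth_mktuple.
Qed.

Lemma dhomog_comp_linear (n k d : nat) (p : {mpoly K[n]})
    (t : n.-tuple {mpoly K[k]}) :
    (forall i, tnth t i \is 1.-homog) -> p \is d.-homog ->
  p \mPo t \is d.-homog.
Proof.
move=> t1 p_d; rewrite comp_mpolyE big_seq; apply: rpred_sum => m m_p.
have <- : (\sum_(i < n) m i)%N = d by rewrite -mdegE; apply: dhomog_mf p_d _ m_p.
apply: dhomogZ.
elim/big_rec2: _ => [|i e q _ q_e]; first exact: dhomog1.
by apply: dhomogM => //; rewrite -[X in X.-homog]mul1n dhomogMn.
Qed.

Lemma dhomog1_expansion (n : nat) (p : {mpoly K[n]}) :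
  p \is 1.-homog -> p = \sum_i p@_U_(i) *: 'X_i.
Proof.
move=> p1; apply/mpolyP => m; rewrite raddf_sum /=.
have [/mdeg1P[i /eqP->]|ne1] := boolP (mdeg m == 1%N).
  rewrite (bigD1 i) //= mcoeffZ mcoeffX eqxx mulr1 big1 ?addr0 // => j ne_ji.
  rewrite mcoeffZ mcoeffX; case: eqP => [/mnmP/(_ i)|]; last by rewrite mulr0.
  by rewrite !mnmE eqxx (negbTE ne_ji).
rewrite (dhomog_nemf_coeff p1 ne1) big1 // => i _; rewrite mcoeffZ mcoeffX.
by case: eqP => [eq_m|]; [rewrite -eq_m mdeg1 in ne1 | rewrite mulr0].
Qed.

Lemma linear_basis_inverse (n : nat) (b : (n.+1).-tuple {mpoly K[n.+1]}) :
    linear_basis b ->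
  exists t : (n.+1).-tuple {mpoly K[n.+1]},
    (forall i, tnth t i \is 1.-homog) /\ forall i, tnth b i \mPo t = 'X_i.
Proof.
case=> b1 b_basis.
have /fin_all_exists[c cE] (j : 'I_n.+1) :
    exists c : {ffun 'I_n.+1 -> K}, 'X_j = \sum_k c k *: tnth b k.
  have [|c [cE _]] := b_basis 'X_j; first by rewrite dhomogX /= mdeg1.
  by exists c.
exists [tuple \sum_k c j k *: 'X_k | j < n.+1]; split=> i.
  rewrite tnth_mktuple; apply: rpred_sum => k _.
  by rewrite dhomogZ // dhomogX /= mdeg1.
have bE := dhomog1_expansion (b1 i).
(* [e] is row [i] of the coefficient matrix of [b] times the matrix [c] expressing the variables in
   [b]. Uniqueness of coordinates forces this product to be the identity. *)
pose e := [ffun k => \sum_j (tnth b i)@_U_(j) * c j k].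
have [e' [_ e'_uniq]] := b_basis _ (b1 i).
have eE : tnth b i = \sum_k e k *: tnth b k.
  rewrite [LHS]bE; under eq_bigr do rewrite cE scaler_sumr.
  rewrite exchange_big; apply: eq_bigr => k _; rewrite ffunE scaler_suml.
  by apply: eq_bigr => j _; rewrite scalerA.
have dE : tnth b i = \sum_k [ffun k => (k == i)%:R] k *: tnth b k.
  rewrite (bigD1 i) //= ffunE eqxx scale1r big1 ?addr0 // => k ne_ki.
  by rewrite ffunE (negbTE ne_ki) scale0r.
have ed : e = [ffun k => (k == i)%:R].
  by rewrite -(e'_uniq _ eE) -(e'_uniq _ dE).
rewrite [X in X \mPo _]bE raddf_sum /=.
transitivity (\sum_k e k *: 'X_k : {mpoly K[n.+1]}).
  under eq_bigr do rewrite comp_mpolyZ comp_mpolyXU -tnth_nth tnth_mktuple scaler_sumr.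
  rewrite exchange_big; apply: eq_bigr => k _; rewrite ffunE scaler_suml.
  by apply: eq_bigr => j _; rewrite scalerA.
rewrite ed (bigD1 i) //= ffunE eqxx scale1r big1 ?addr0 // => k ne_ki.
by rewrite ffunE (negbTE ne_ki) scale0r.
Qed.

(** The inverse linear substitution recovers [G] from [G \mPo b], and linear substitutions preserve
    homogeneity. *)
Lemma dhomog_linear_basis (n d : nat) (b : (n.+1).-tuple {mpoly K[n.+1]})
    (G : {mpoly K[n.+1]}) :
  linear_basis b -> G \mPo b \is d.-homog -> G \is d.-homog.
Proof.
move=> /linear_basis_inverse[t [t1 bt]] /(dhomog_comp_linear t1).
rewrite comp_mpolyA (_ : [tuple _ | i < _] = [tuple 'X_i | i < n.+1]).
  by rewrite comp_mpoly_id.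
by apply: eq_from_tnth => i; rewrite !tnth_mktuple bt.
Qed.

Lemma set_first_to_oneX (n : nat) (m : 'X_{1..n.+1}) :
  set_first_to_one ('X_[m] : {mpoly K[n.+1]}) =
  'X_[[multinom m (lift ord0 j) | j < n]].
Proof.
rewrite /set_first_to_one comp_mpolyX big_ord_recl tnth_mktuple unlift_none.
rewrite expr1n mul1r mpolyXE_id; apply: eq_bigr => j _.
by rewrite tnth_mktuple liftK mnmE.
Qed.

(** The expression [G] of [F] in the new basis is again homogeneous of degree [d], and setting the
    first variable to 1 can only lower the degree of a monomial. *)
Lemma msize_dual_generator (n d : nat) (F l : {mpoly K[n.+1]})
    (z : n.-tuple {mpoly K[n.+1]}) (f : {mpoly K[n]}) :
    F \is d.-homog -> linear_basis [tuple of l :: z] ->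
    dual_generator F l z f ->
  (msize f <= d.+1)%N.
Proof.
move=> F_d lz_basis [G GF ->].
have /dhomogP G_d : G \is d.-homog by apply: dhomog_linear_basis lz_basis _; rewrite GF.
rewrite msizeE; apply/bigmax_leqP_seq => a; rewrite mcoeff_msupp => nz_a _.
rewrite ltnS leqNgt; apply: contra nz_a => lt_da.
rewrite /divided_power /set_first_to_one [_ \mPo _]raddf_sum.
rewrite raddf_sum big1_seq //= => m /G_d m_d.
rewrite comp_mpolyZ mcoeffZ -[_ \mPo _]/(set_first_to_one _) set_first_to_oneX.
rewrite mcoeffX; case: eqP => [a_m|]; last by rewrite mulr0.
suff: (mdeg a <= d)%N by rewrite leqNgt lt_da.
rewrite -a_m -m_d mdegE [X in (_ <= X)%N](mdegE m) big_ord_recl.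
by rewrite (eq_bigr (fun j => m (lift ord0 j))) ?leq_addl // => j _; rewrite mnmE.
Qed.

Lemma set_first_to_one_homogenization (n : nat) (g : {mpoly K[n]}) :
  set_first_to_one (homogenization g) = g.
Proof.
rewrite /homogenization /set_first_to_one raddf_sum [RHS]mpolyE.
apply: eq_bigr => m _ /=; rewrite comp_mpolyZ rmorphM rmorphXn rmorph_prod /=.
rewrite comp_mpolyXU -tnth_nth tnth_mktuple unlift_none expr1n mul1r.
congr (_ *: _); rewrite [RHS]mpolyXE_id; apply: eq_bigr => i _.
by rewrite rmorphXn /= comp_mpolyXU -tnth_nth tnth_mktuple liftK.
Qed.

(** Dehomogenization is a ring morphism undoing homogenization: it sends the generators of [Z] back
    into the ideal [Ann f], and each [g] in [Ann f] is the image of its own homogenization. *)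
Lemma chart_ideal_evinced (n : nat) (f : {mpoly K[n]})
    (Z : {mpoly K[n.+1]} -> Prop) :
    (forall G, Z G <-> homogenized_ideal (Ann f) G) ->
  forall g, chart_ideal Z g <-> Ann f g.
Proof.
move=> ZE g; split=> [[G /ZE[s [s_Ann ->]] ->]|g0].
  rewrite /set_first_to_one raddf_sum big_seq /=.
  elim/big_ind: _ => [||cg /s_Ann[h h0 cgE]]; [exact: Ann0|exact: AnnD|].
  rewrite rmorphM /= cgE -[homogenization h \mPo _]/(set_first_to_one _).
  by rewrite set_first_to_one_homogenization; apply: Ann_mull.
exists (homogenization g); last by rewrite set_first_to_one_homogenization.
apply/ZE; exists [:: (1, homogenization g)]; split=> [cg|].
  by rewrite inE => /eqP-> /=; exists g.
by rewrite big_seq1 mul1r.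
Qed.

End Substitution.

(** * Binomial arithmetic and the length bound *)

Lemma sum_bin_half (n k : nat) : (0 < k)%N ->
  ('C(n + k - 1, n) + 'C(n + k, n))%:R =
    (n + 2 * k)%:R / k%:R * 'C(n + k - 1, n)%:R :> rat.
Proof.
case: k => // k _; rewrite addnS subn1 /=.
have kC : (k.+1 * 'C((n + k).+1, n) = (n + k).+1 * 'C(n + k, n))%N.
  by rewrite mul_bin_down -addnS addKn.
have k_neq0 : k.+1%:R != 0 :> rat by rewrite pnatr_eq0.
apply: (mulfI k_neq0); rewrite mulrA [_%:R * (_ / _)]mulrC divfK // -!natrM.
by rewrite mulnDr kC -mulnDl; congr (_ * _)%:R; rewrite -addnS addnCA mul2n addnn.
Qed.

Theorem proposition3p12 (K : fieldType) (n d : nat)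
    (hn : (1 <= n)%N) (hd : (1 <= d)%N)
    (hchar : forall p : nat, p \in [pchar K] -> (d < p)%N)
    (F : {mpoly K[n.+1]}) (hF : F \is d.-homog) (hF0 : F != 0)
    (Z : {mpoly K[n.+1]} -> Prop) (hZ : evinced d F Z) :
  exists r : nat,
    [/\ scheme_length Z r,
        forall k : nat, d = (2 * k)%N ->
          r%:R <= (n + 2 * k)%:R / k%:R * 'C(n + k - 1, n)%:R :> rat
      & forall k : nat, d = (2 * k + 1)%N -> (r <= 2 * 'C(n + k, n))%N].
Proof.
case: hZ => l [j [omega [z [f [_ lz_basis f_dual ZE]]]]].
have f_d := msize_dual_generator hF lz_basis f_dual.
exists (\rank (hankel d.+1 f)); split=> [|k dk|k dk].
- exact: quotient_dim_hankel (chart_ideal_evinced ZE).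
- have k_gt0 : (0 < k)%N by move: hd; rewrite dk; case: (k).
  rewrite -sum_bin_half // ler_nat.
  have le_kd : (k <= d.+1)%N by rewrite dk mul2n -addnn -addnS leq_addr.
  apply: leq_trans (rank_hankel_le f_d le_kd) _.
  have -> : (d.+1 - k = k.+1)%N by rewrite dk mul2n -addnn -addnS addKn.
  (* [card_bmultinom_le] needs a successor as degree bound, so [k] becomes [k'.+1]: degrees below
     [k] are degrees at most [k']. *)
  case: (k) k_gt0 => // k' _; rewrite addnS subn1 /= -addnS ![(n + _)%N]addnC.
  by rewrite leq_add ?card_bmultinom_le.
- have le_kd : (k.+1 <= d.+1)%N by rewrite dk ltnS mul2n -addnn -addnA leq_addr.
  apply: leq_trans (rank_hankel_le f_d le_kd) _.
  have -> : (d.+1 - k.+1 = k.+1)%N by rewrite dk subSS mul2n -addnn -addnA addKn addn1.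
  by rewrite addnn -mul2n leq_mul2l addnC card_bmultinom_le.
Qed.
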